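(* Let $(X,f)$ be a dynamical system, where $X$ is a (compact) Hausdorff uniform space and $f:X\to X$ is a continuous onto map. If the set $M(f)$ of minimal points of $f$ is not dense in $X$, then $f$ does not have topological $(\mathscr{P}(\mathbb{N}),\mathscr{F}_{ps})$-shadowing.
   Context: Here $\mathbb{N}=\{1,2,\dots\}$. A dynamical system is a pair $(X,f)$ where $X$ is a compact uniform space with uniformity $\mathscr{U}$ (whose members are called entourages) and $f:X\to X$ is a continuous onto map. A set $S\subset\mathbb{N}$ is syndetic if it is infinite and there is $M\in\mathbb{N}$ bounding the gaps between consecutive elements of $S$; a set is thick if it contains arbitrarily long blocks of consecutive integers; a set is piecewise syndetic if it is of the form $T\cap S$ with $T$ thick and $S$ syndetic. $\mathscr{F}_{ps}$ is the family of piecewise syndetic subsets of $\mathbb{N}$, and $\mathscr{P}(\mathbb{N})$ is the family of all subsets of $\mathbb{N}$ (including the empty set). A point $x\in X$ is minimal if $\{n\in\mathbb{N}:f^n(x)\in U\}$ is syndetic for every open set $U$ containing $x$; $M(f)$ is the set of minimal points. For an entourage $D$ and $A\subset\mathbb{N}$, a sequence $\{x_i\}_{i=1}^\infty$ in $X$ is a $D$-pseudo orbit on $A$ if $A\subset\{i:(f(x_i),x_{i+1})\in D\}$. For an entourage $E$ and $B\subset\mathbb{N}$, $\{x_i\}_{i=1}^\infty$ is $E$-shadowed by $y\in X$ on $B$ if $B\subset\{i:(f^i(y),x_i)\in E\}$. For families $\mathscr{F},\mathscr{G}$ of subsets of $\mathbb{N}$, $f$ has topological $(\mathscr{F},\mathscr{G})$-shadowing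 if for every entourage $E$ there is an entourage $D$ such that whenever $\{x_i\}_{i=1}^\infty$ is a $D$-pseudo orbit on some $A\in\mathscr{F}$, there is a point $x\in X$ such that $\{x_i\}_{i=1}^\infty$ is $E$-shadowed by $x$ on some $B\in\mathscr{G}$. *)

(* Defs.v *)
From HB Require Import structures.
From mathcomp Require Import all_boot.
From mathcomp Require Import all_classical.
From mathcomp Require Import topology.

Set Implicit Arguments.
Unset Strict Implicit.
Unset Printing Implicit Defensive.

Local Open Scope classical_set_scope.

(* Here N = {1, 2, ...}: subsets of N are the [A : set nat] with [A `<=` posn],
   and a sequence (x_i)_(i >= 1) is an [x : nat -> X] whose value [x 0] is never
   looked at. *)
Definition posn : set nat := [set n | 0 < n].

Definition syndetic (S : set nat) : Prop :=
  [/\ S `<=` posn, infinite_set S &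
      exists2 M, posn M &
        forall a b, S a -> S b -> a < b ->
          (forall c, a < c < b -> ~ S c) -> b - a <= M].

Definition thick (T : set nat) : Prop :=
  T `<=` posn /\ forall n, exists m, forall i, i < n -> T (m + i).

Definition piecewise_syndetic : set_system nat :=
  [set A | exists T S, [/\ thick T, syndetic S & A = T `&` S]].

Definition all_subsets_posn : set_system nat := [set A | A `<=` posn].

Definition minimal_point (X : topologicalType) (f : X -> X) (x : X) : Prop :=
  forall U : set X, open U -> U x ->
    syndetic [set n | posn n /\ U (iter n f x)].

Definition minimal_points (X : topologicalType) (f : X -> X) : set X :=
  [set x | minimal_point f x].

Definition pseudo_orbit_on (X : uniformType) (f : X -> X) (D : set (X * X))
    (A : set nat) (x : nat -> X) : Prop :=
  A `<=` [set i | posn i /\ D (f (x i), x i.+1)].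

Definition shadowed_on (X : uniformType) (f : X -> X) (E : set (X * X))
    (B : set nat) (x : nat -> X) (y : X) : Prop :=
  B `<=` [set i | posn i /\ E (iter i f y, x i)].

Definition topological_shadowing (F G : set_system nat) (X : uniformType)
    (f : X -> X) : Prop :=
  forall E : set (X * X), entourage E ->
    exists2 D : set (X * X), entourage D &
      forall x : nat -> X,
        (exists2 A, F A & pseudo_orbit_on f D A x) ->
        exists y : X, exists2 B, G B & shadowed_on f E B x y.

(* Main.v *)
Require Import Defs.
From mathcomp Require Import all_boot.
From mathcomp Require Import all_classical.
From mathcomp Require Import topology.

Local Open Scope classical_set_scope.

(** The empty set is a member of P(N), so shadowing applies to an arbitrary
    sequence, in particular to one that is constant at a point z outside the
    closure of the minimal points.  A shadowing point visits a small closed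
    neighbourhood C of z along a piecewise syndetic set, so a cluster point of
    its iterates taken at the beginnings of longer and longer blocks visits C
    with bounded gaps, forever.  The points with this recurrence form a nonempty
    closed invariant set; a minimal subsystem of it consists of minimal points
    and meets C, a contradiction. *)

Definition subsystem {X : topologicalType} (f : X -> X) (Y : set X) : Prop :=
  [/\ closed Y, Y !=set0 & forall x, Y x -> Y (f x)].

Definition minimal_subsystem {X : topologicalType} (f : X -> X) (Y : set X) :
    Prop :=
  subsystem f Y /\ forall Z, subsystem f Z -> Z `<=` Y -> Y `<=` Z.

Lemma syndetic_of_gaps (A : set nat) (N : nat) : A `<=` posn ->
  (forall m, exists2 n, m < n <= m + N & A n) -> syndetic A.
Proof.
move=> Apos Agap; split=> //.
  move=> /finite_seqP[s As].
  have [n /andP[ltn _] An] := Agap (\max_(i <- s) i).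
  have : n \in s by move: An; rewrite As.
  move=> /(@leq_bigmax_seq _ s predT id)/(_ isT).
  by rewrite leqNgt ltn.
exists N.
  by have [n /andP[n0 nN] _] := Agap 0; exact: leq_trans n0 nN.
move=> a b Aa Ab ab noc; have [n /andP[an na] An] := Agap a.
rewrite leq_subLR (leq_trans _ na)// leqNgt; apply/negP => nb.
by apply: (noc n) => //; rewrite an.
Qed.

Lemma syndetic_gaps (S : set nat) : syndetic S ->
  exists s M, forall k, s <= k -> exists2 j, j <= M & S (k + j).
Proof.
move=> [_ Sinf [M _ Sgap]].
have Sunb k : exists b, `[< S b >] && (k < b).
  apply: contrapT => nb; apply: Sinf.
  apply: (@sub_finite_set _ _ `I_k.+1); last exact: finite_II.
  move=> a Sa /=; rewrite ltnS leqNgt; apply/negP => ka.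
  by apply: nb; exists a; rewrite ka andbT; apply/asboolP.
have [s /andP[/asboolP Ss _]] := Sunb 0.
exists s, M => k sk.
have ex_a : exists a, `[< S a >] && (a <= k).
  by exists s; rewrite sk andbT; apply/asboolP.
have ub_a a : `[< S a >] && (a <= k) -> a <= k by case/andP.
(* The last element [a] up to [k] and the first element [b] after [k] are consecutive in [S], so the
   gap bound gives [b - k <= b - a <= M]. The condition [s <= k] ensures that [a] exists. *)
case: (ex_maxnP ex_a ub_a) => a /andP[/asboolP Sa ak] amax.
case: (ex_minnP (Sunb k)) => b /andP[/asboolP Sb kb] bmin.
exists (b - k); last by rewrite subnKC // ltnW.
apply: leq_trans (leq_sub2l b ak) _.
apply: Sgap => //; first exact: leq_ltn_trans kb.
move=> c /andP[ac cb] Sc; have [ck|kc] := leqP c k.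
  by have := amax c; rewrite ck (asboolT Sc) leqNgt ac => /(_ isT).
by have := bmin c; rewrite kc (asboolT Sc) leqNgt cb => /(_ isT).
Qed.

Section Dynamics.
Context {X : topologicalType} {f : X -> X}.
Hypothesis cf : continuous f.

Lemma continuous_iter n : continuous (iter n f).
Proof.
elim: n => [|n IHn] x; first exact: cvg_id.
by apply: (@continuous_comp _ _ _ (iter n f) f); [exact: IHn | exact: cf].
Qed.

Lemma subsystem_iter Y n x : subsystem f Y -> Y x -> Y (iter n f x).
Proof. by move=> [_ _ invY] Yx; elim: n => //= n; exact: invY. Qed.

(** Any cluster point of [w] serves as [q], since a closed set containing a tail contains all
    cluster points. This stands in for convergent subsequences, which compactness alone does not
    provide. *)
Lemma compact_seq_limit (K : set X) (w : nat -> X) : compact K ->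
  (forall n, K (w n)) ->
  exists2 q, K q &
    forall C N, closed C -> (forall n, N <= n -> C (w n)) -> C q.
Proof.
move=> Kc Kw.
have [|q [Kq clq]] := Kc (w @ \oo) (fmap_proper_filter _ _).
  by exists 0 => // n _; exact: Kw.
exists q => // C N cC Cw; apply: cC => B qB; apply: clq => //.
by apply: filterS (nbhs_infty_ge N) => n; exact: Cw.
Qed.

Lemma orbit_closure_subsystem x :
  subsystem f (closure (range (fun n => iter n f x))).
Proof.
split; first exact: closed_closure.
  by exists x; apply: subset_closure; exists 0.
move=> y cly B /cf /cly[_ [[n _ <-] Bn]].
by exists (f (iter n f x)); split=> //; exists n.+1.
Qed.

(** By minimality every orbit closure in [Y] is all of [Y], so every orbit enters [U]; compactness
    then bounds the entry time uniformly over [Y]. *)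
Lemma minimal_subsystem_points Y : compact Y -> minimal_subsystem f Y ->
  Y `<=` minimal_points f.
Proof.
move=> Yc [sY minY] p Yp U oU Up.
have [closedY _ invY] := sY.
(* Starting the orbit at [f q] makes the visiting time positive. *)
have visit q : Y q -> exists n, U (iter n.+1 f q).
  move=> Yq.
  have : closure (range (fun n => iter n f (f q))) p.
    apply: minY Yp; first exact: orbit_closure_subsystem.
    move=> y cly; apply: closedY => B /cly[_ [[n _ <-] Bn]].
    exists (iter n f (f q)); split=> //.
    by apply: subsystem_iter sY _; exact: invY.
  move=> /(_ U (open_nbhs_nbhs (conj oU Up)))[_ [[n _ <-] Un]].
  by exists n; rewrite iterSr.
have [N bound] : exists N, forall q, Y q ->
    exists2 n, n <= N & U (iter n.+1 f q).
  (* Otherwise some [w N] in [Y] avoids [U] at times 1 to [N.+1], for each [N]; a limit [q] of these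
     would avoid [U] at all positive times, against [visit]. *)
  apply: contrapT => noN.
  have /choice[w w_bad] N : exists q, Y q /\
      forall n, n <= N -> ~ U (iter n.+1 f q).
    apply: contrapT => noq; apply: noN; exists N => q Yq.
    apply: contrapT => non; apply: noq; exists q; split=> // n nN Un.
    by apply: non; exists n.
  have [n|q Yq lim_q] := compact_seq_limit _ w Yc; first by case: (w_bad n).
  have [n Un] := visit q Yq.
  suff : (~` (iter n.+1 f @^-1` U)) q by [].
  apply: (lim_q _ n).
    apply: open_closedC; have /continuousP := continuous_iter n.+1; exact.
  by move=> m nm; have [_] := w_bad m; apply.
apply: (@syndetic_of_gaps _ N.+1) => [n []//|m].
have [n nN Un] := bound _ (subsystem_iter _ m _ sY Yp).
exists (n.+1 + m).
  by rewrite addSn ltnS leq_addl /= addnS ltnS addnC leq_add2l.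
by split; [rewrite /posn /= addSn | rewrite iterD].
Qed.

Lemma minimal_subsystem_exists K : compact K -> subsystem f K ->
  exists2 Y, Y `<=` K & minimal_subsystem f Y.
Proof.
move=> Kc sK; have [closedK K0 invK] := sK.
(* Zorn's lemma is applied to complements.  Only [Y `&` K !=set0] is required
   of Y, so that the empty chain has the upper bound [set0]. *)
pose P (A : set X) := [/\ closed (~` A), ~` A `&` K !=set0 &
  forall x, (~` A) x -> (~` A) (f x)].
have [F FP Ftot|A [[clA A0 invA] maxA]] := @Zorn_bigcup X P.
  split.
  - by rewrite setC_bigcup; apply: closed_bigI => A /FP[].
  - have [->|/set0P[A0 FA0]] := eqVneq F set0.
      by rewrite bigcup_set0 setC0 setTI.
    (* The traces on [K] of the complements form a chain of nonempty closed sets; a cluster point of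
       the filter they generate lies in all of them. *)
    pose G := filter_from F (fun A => ~` A `&` K).
    have FG : Filter G.
      apply: filter_from_filter; first by exists A0.
      move=> A B FA FB; have [AB|BA] := Ftot A B FA FB.
        by exists B => // x [Bx Kx]; do !split=> //; move/AB.
      by exists A => // x [Ax Kx]; do !split=> //; move/BA.
    have PG : ProperFilter G.
      by apply: filter_from_proper => A /FP[].
    have [|q [Kq clq]] := Kc G PG; first by exists A0 => // x [].
    exists q; split=> // -[A FA Aq].
    have [clA _ _] := FP A FA.
    suff : (~` A) q by [].
    apply: clA => B qB; apply: clq => //.
    by exists A => // x [].
  - move=> x nx [A FA Afx]; have [_ _ invA] := FP A FA.
    by apply: (invA x) Afx => Ax; apply: nx; exists A.
exists (~` A `&` K); first by move=> x [].
split.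
  by split=> [|//|x [Ax Kx]]; [exact: closedI | split; [exact: invA|exact: invK]].
move=> Z [clZ Z0 invZ] ZA x [Ax Kx]; apply: contrapT => nZx.
apply: (maxA (~` Z)).
  split; first by move=> y Ay Zy; have [] := ZA y Zy.
  by move=> sub; exact/Ax/sub.
split; rewrite setCK //; have [z Zz] := Z0.
by exists z; split=> //; have [] := ZA z Zz.
Qed.

Lemma piecewise_syndetic_visits (C : set X) (y : X) (B : set nat) :
  compact [set: X] -> closed C -> piecewise_syndetic B ->
  (forall i, B i -> C (iter i f y)) -> C `&` minimal_points f !=set0.
Proof.
move=> Xc clC [T [S [[_ thickT] /syndetic_gaps[s [M gapS]] ->]]] BC.
pose K := [set w | forall k, exists2 j, j <= M & C (iter (k + j) f w)].
have KE : K = \bigcap_k \bigcup_(j in `I_M.+1) (iter (k + j) f @^-1` C).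
  apply/seteqP; split=> [w Kw k _|w Kw k].
    by have [j jM Cj] := Kw k; exists j.
  by have [j jM Cj] := Kw k I; exists j.
have closedK : closed K.
  rewrite KE; apply: closed_bigI => k _; apply: closed_bigcup.
    exact: finite_II.
  by move=> j _; have /continuous_closedP := continuous_iter (k + j); exact.
have Kc : compact K by exact: subclosed_compact closedK Xc (@subsetT _ _).
have sK : subsystem f K.
  split=> //; last first.
    move=> w Kw k; have [j jM Cj] := Kw k.+1.
    by exists j => //; rewrite -iterSr -addSn.
  (* The block must contain the times [m n + s + k + j] for [k <= n] and [j <= M]; the shift by [s]
     brings them into the range where the gaps of [S] are bounded. *)
  have /choice[m Tm] n := thickT (s + n + M.+1).
  have [//|q _ lim_q] :=
    @compact_seq_limit _ (fun n => iter (m n + s) f y) Xc.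
  exists q => /= k.
  suff : (\bigcup_(j in `I_M.+1) (iter (k + j) f @^-1` C)) q.
    by move=> [j jM Cj]; exists j.
  apply: (lim_q _ k).
    apply: closed_bigcup; first exact: finite_II.
    by move=> j _; have /continuous_closedP := continuous_iter (k + j); exact.
  move=> n kn; have [|j jM Sj] := gapS (m n + s + k).
    by rewrite -addnA addnCA leq_addr.
  exists j => //=; rewrite -iterD; apply: BC.
  have -> : k + j + (m n + s) = m n + s + k + j by rewrite addnC addnA.
  split=> //; rewrite -!addnA; apply: Tm.
  by rewrite -addnA ltn_add2l -addnS leq_add.
have [Y YK minY] := minimal_subsystem_exists K Kc sK.
have [sY _] := minY; have [clY [p Yp] _] := sY.
have Yc : compact Y by exact: subclosed_compact clY Xc (@subsetT _ _).
have [j _ Cj] := YK p Yp 0; exists (iter j f p); split=> //.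
by apply: (minimal_subsystem_points Y Yc minY); exact: subsystem_iter.
Qed.

End Dynamics.

Theorem theorem4p5 (X : uniformType) (f : X -> X) :
  compact [set: X] -> hausdorff_space X ->
  continuous f -> set_surj [set: X] [set: X] f ->
  ~ dense (minimal_points f) ->
  ~ topological_shadowing all_subsets_posn piecewise_syndetic f.
Proof.
move=> Xc _ cf _ ndense shadow; apply: ndense => U [z Uz] oU.
have [V nV VU] := uniform_regular (open_nbhs_nbhs (conj oU Uz)).
have [E entE EV] := (nbhsP z V).1 nV.
(* Shadowing puts the orbit in the first coordinate, whereas the section of [E] at [z] puts [z]
   there; hence the inverse entourage. *)
have [D _ shadowD] := shadow _ (entourage_inv entE).
have [|y [B psB By]] := shadowD (fun=> z).
  by exists set0 => // n.
have [|p [Cp minp]] := piecewise_syndetic_visits cf (closure V) y B Xc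
  (@closed_closure _ _) psB.
  move=> i /By[_ Ei]; apply: subset_closure; apply: EV.
  by rewrite /xsection /=; apply/mem_set.
by exists p; split=> //; exact: VU.
Qed.
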